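(* Let $n\ge 2$, let $S^n\subset\mathbb{R}^{n+1}$ be the unit sphere with its canonical metric, and put $$\overline{S}^{n-1}_+:=\{(x_1,x_2,\dots,x_{n+1})\in S^n:\ x_1=0,\ x_2\ge 0\}.$$ Then $\mathbb{V}:=S^n\setminus\overline{S}^{n-1}_+$ is a maximal open convex supporting subset of $S^n$.
   Context: A $C^2$-function $F$ on an open subset $U$ of a Riemannian manifold is strictly convex on $U$ if its Hessian form $\mathrm{Hess}\,F(X,X)=\nabla_X\nabla_XF-(\nabla_XX)F$ is positive for every nonzero tangent vector $X\in TU$. A subset $U$ of a Riemannian manifold $M$ is called convex supporting if every compact subset of $U$ has an open neighborhood in $M$ on which there is defined a strictly convex function. An open convex supporting set is maximal if it is not properly contained in any other open convex supporting set. *)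

(* Defs.v *)
From HB Require Import structures.
From mathcomp Require Import all_boot all_order all_algebra.
From mathcomp Require Import all_classical all_reals all_analysis.
Set Implicit Arguments.
Unset Strict Implicit.
Unset Printing Implicit Defensive.
Import Order.TTheory GRing.Theory Num.Theory.
Import numFieldNormedType.Exports.
Local Open Scope classical_set_scope.
Local Open Scope ring_scope.

(* Functions and vector fields on a subset of S^n are total functions on
   R^(n+1); none of the notions below depends on their values off that subset. *)

Section EuclideanSpace.
Context {R : realType} {n : nat}.
Local Notation E := 'rV[R]_n.+1.

Definition dot (u v : E) : R := \sum_(i < n.+1) u 0 i * v 0 i.

(* The library norm on row vectors is the sup norm (it gives the same topology
   and the same derivatives), so the unit sphere is defined with [dot]. *)
Definition sphere : set E := [set x | dot x x = 1].

(* The smooth retraction y |-> y / |y| of R^(n+1) \ {0} onto the sphere. *)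
Definition retr (y : E) : E := (Num.sqrt (dot y y))^-1 *: y.

Fixpoint Ck {V : normedModType R} (k : nat) (W : set E) (f : E -> V) : Prop :=
  match k with
  | 0 => forall x, W x -> {for x, continuous f}
  | k'.+1 => (forall x, W x -> differentiable f x) /\
             (forall v : E, Ck k' W ('D_v f))
  end.

End EuclideanSpace.

Section Sphere.
Context {R : realType} {n : nat}.
Local Notation E := 'rV[R]_n.+1.

Definition sphere_open (U : set E) : Prop :=
  exists2 W : set E, open W & U = sphere `&` W.

(* C^k maps on a (relatively open) subset of the submanifold S^n: those that
   extend locally to C^k maps on open subsets of R^(n+1). *)
Definition sphere_Ck {V : normedModType R} (k : nat) (U : set E)
    (f : E -> V) : Prop :=
  forall p, U p -> exists (W : set E) (g : E -> V),
    [/\ open W, W p, Ck k W g & forall x, (U `&` W) x -> g x = f x].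

(* The derivative at p in S^n of a map f along v in T_p S^n, computed along the
   curve t |-> (p + t v) / |p + t v| of S^n, which has velocity v at p. *)
Definition tangent_derive {V : normedModType R} (f : E -> V) (p v : E) : V :=
  'D_v (f \o retr) p.

Definition tangent_proj (p w : E) : E := w - dot w p *: p.

Definition smooth_vector_field (U : set E) (X : E -> E) : Prop :=
  (forall k, sphere_Ck k U X) /\ (forall p, U p -> dot (X p) p = 0).

(* nabla_X F = X F *)
Definition nabla_fun (X : E -> E) (F : E -> R) (p : E) : R :=
  tangent_derive (F : E -> R^o) p (X p).

(* The Levi-Civita connection of the metric induced by R^(n+1): the tangential
   component of the Euclidean derivative. *)
Definition nabla (X Y : E -> E) (p : E) : E :=
  tangent_proj p (tangent_derive Y p (X p)).

Definition Hess (F : E -> R) (X : E -> E) (p : E) : R :=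
  nabla_fun X (nabla_fun X F) p - nabla_fun (nabla X X) F p.

(* [Hess F X p] depends on the vector field X only through X p, and every
   tangent vector of U is the value of a smooth vector field on U. *)
Definition strictly_convex (U : set E) (F : E -> R) : Prop :=
  sphere_Ck 2 U (F : E -> R^o) /\
  (forall X, smooth_vector_field U X ->
   forall p, U p -> X p != 0 -> 0 < Hess F X p).

Definition convex_supporting (U : set E) : Prop :=
  U `<=` sphere /\
  forall K : set E, compact K -> K `<=` U ->
  exists W : set E, [/\ sphere_open W, K `<=` W &
    exists F : E -> R, strictly_convex W F].

Definition maximal_open_convex_supporting (U : set E) : Prop :=
  [/\ sphere_open U, convex_supporting U &
    forall U' : set E, sphere_open U' -> convex_supporting U' -> ~ (U `<` U')].

End Sphere.

Arguments sphere R n : clear implicits.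

(* The coordinates x_1, x_2 are those of index 0 and 1; [inord 1] is the index 1
   as soon as 1 <= n. *)
Definition half_equator (R : realType) (n : nat) : set 'rV[R]_n.+1 :=
  [set x | [/\ sphere R n x, x 0 ord0 = 0 & 0 <= x 0 (inord 1)]].
Arguments half_equator R n : clear implicits.

(* Main.v *)
From HB Require Import structures.
Require Import Defs.
From mathcomp Require Import all_boot all_order all_algebra.
From mathcomp Require Import all_classical all_reals all_analysis.
From mathcomp Require Import ring lra.
Set Implicit Arguments.
Unset Strict Implicit.
Unset Printing Implicit Defensive.
Import Order.TTheory GRing.Theory Num.Theory.
Import numFieldNormedType.Exports.
Local Open Scope classical_set_scope.
Local Open Scope ring_scope.

(** Write x_1 = r sin phi, x_2 = - r cos phi. The half-equator consists of the
points with r = 0 or phi = pi; on its complement V the radius r is positive and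
the angle phi is a smooth function with values strictly between -pi and pi.

V is convex supporting. On a compact subset of V the quantity r ^ 2 stays above
some m > 0, so it is enough to find a strictly convex function on the part of V
where r ^ 2 > m. The level sets of phi are pieces of totally geodesic
hypersurfaces, and Hess phi = - (2 / r) dr dphi vanishes on their tangent
spaces. Adding eps / r ^ 2 bends them all to the same side: for small eps the
Hessian of psi = phi + eps / r ^ 2 is positive on the kernel of dpsi
([hess_form_gt0]). The remaining direction is taken care of by composing with a
steep exponential, since
Hess (exp (L psi)) = L exp (L psi) (Hess psi + L dpsi ^ 2)
([strictly_convex_exp_tilted_angle]).

V is maximal. An open set strictly larger than V contains a point q of the
relative interior of the half-equator, because it is open. The great circle
through q and (1, 0, ..., 0) meets the half-equator in q only, so it lies in the
larger set ([great_circle_half_equator]). A strictly convex function F near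
this closed geodesic would have a periodic derivative along it that is strictly
increasing, which is absurd ([no_strictly_convex_great_circle]).

Both halves go through the Hessian of the statement, which is defined by means
of the retraction onto the sphere: if F is the restriction of a C^2 function g
on an open set of the ambient space, then
Hess F (X, X) = D^2 g (X, X) - |X|^2 D_p g at p ([Hess_extension]). *)

(** * Derivatives of vector-valued maps *)

Section RowVectorCalculus.
Context {R : realType} {V : normedModType R}.

(** A map into row vectors is the finite sum of its coordinates times the
basis vectors, and each summand is handled by scalar differentiability. *)
Lemma differentiable_row m (f : V -> 'rV[R]_m) x :
  (forall i, differentiable (fun y => f y 0 i) x) -> differentiable f x.
Proof.
move=> df.
have -> : f = \sum_(i < m) (fun y => f y 0 i *: delta_mx 0 i).
  apply/funext => y; rewrite {1}[f y]row_sum_delta fct_sumE.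
  by [].
by apply: differentiable_sum => i; exact: differentiableZl.
Qed.

Lemma differentiable_comp_coord m (f : V -> 'rV[R]_m) x i :
  differentiable f x -> differentiable (fun y => f y 0 i) x.
Proof.
move=> df; apply: (@differentiable_comp _ _ _ _ f (fun M => M 0 i)) => //.
exact: differentiable_coord.
Qed.

Lemma derive_coord m (f : V -> 'rV[R]_m) x v i :
  derivable f x v -> 'D_v (fun y => f y 0 i) x = ('D_v f x) 0 i.
Proof. by move=> df; rewrite derive_mx// mxE. Qed.

Lemma deriveDl (W : normedModType R) (f : V -> W) x u v :
  differentiable f x -> 'D_(u + v) f x = 'D_u f x + 'D_v f x.
Proof. by move=> df; rewrite !deriveE// linearD. Qed.

Lemma deriveZl (W : normedModType R) (f : V -> W) x a v :
  differentiable f x -> 'D_(a *: v) f x = a *: 'D_v f x.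
Proof. by move=> df; rewrite !deriveE// linearZ. Qed.

(** The differential is characterized by a first-order expansion at [x], which
only sees the germ of the map. *)
Lemma near_eq_differentiable (W : normedModType R) (f g : V -> W) x :
  (\near x, f x = g x) -> differentiable f x -> differentiable g x.
Proof.
move=> fg df.
have g_eq : g \o shift x = cst (g x) + 'd f x +o_ 0 id.
  apply/eqaddoP => e e0; have /eqaddoP/(_ e e0) := diff_locally df.
  apply: filterS2; last first.
    by have := fg; rewrite (near_shift 0); exact.
  rewrite /= => h fgh; rewrite !fctE /= subr0 in fgh *.
  by rewrite -(nbhs_singleton fg) -fgh.
have dg := diff_unique (diff_continuous df) g_eq.
by apply/diff_locallyP; rewrite dg; split => //; exact: diff_continuous.
Qed.

(** Differentiability is assumed at the maximum only, so the sign is read off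
the difference quotients from the right. *)
Lemma derive_le0_of_max (h : V -> R) x v :
  derivable (h : V -> R^o) x v -> (forall s : R, h (s *: v + x) <= h x) ->
  'D_v (h : V -> R^o) x <= 0.
Proof.
move=> dh hmax; rewrite /derive cvg_at_rightE//.
apply: limr_le.
  rewrite -(cvg_at_rightE (fun s : R =>
    s^-1 *: ((h \o shift x) (s *: v) - h x : R^o)))//.
  apply: cvg_trans dh; apply: cvg_app.
  move=> A [e egt0 Ae]; exists e => // s xe sgt0; apply: Ae => //.
  exact/lt0r_neq0.
near=> s; apply: mulr_ge0_le0; first by rewrite invr_ge0.
by rewrite subr_le0; exact: hmax.
Unshelve. all: by end_near. Qed.

End RowVectorCalculus.

(** * The Euclidean inner product *)

Section Dot.
Context {R : realType} {n : nat}.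
Local Notation E := 'rV[R]_n.+1.
Implicit Types u v w x y : E.

Lemma dotC u v : dot u v = dot v u.
Proof. by apply: eq_bigr => i _; rewrite mulrC. Qed.

Lemma dotDl u v w : dot (u + v) w = dot u w + dot v w.
Proof.
by rewrite /dot -big_split; apply: eq_bigr => i _; rewrite /= mxE mulrDl.
Qed.

Lemma dotZl a u v : dot (a *: u) v = a * dot u v.
Proof. by rewrite /dot mulr_sumr; apply: eq_bigr => i _; rewrite mxE mulrA. Qed.

Lemma dotDr u v w : dot w (u + v) = dot w u + dot w v.
Proof. by rewrite dotC dotDl !(dotC w). Qed.

Lemma dotZr a u v : dot v (a *: u) = a * dot v u.
Proof. by rewrite dotC dotZl dotC. Qed.

Lemma dotNl u v : dot (- u) v = - dot u v.
Proof. by rewrite -scaleN1r dotZl mulN1r. Qed.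

Lemma dot_ge0 u : 0 <= dot u u.
Proof. by apply: sumr_ge0 => i _; rewrite -expr2 sqr_ge0. Qed.

Lemma dot_gt0 u : u != 0 -> 0 < dot u u.
Proof.
move=> u0; rewrite lt_neqAle dot_ge0 andbT eq_sym; apply: contra u0 => /eqP u0.
apply/eqP/rowP => i; rewrite mxE; apply/eqP.
have : u 0 i * u 0 i = 0.
  apply: (psumr_eq0P (P := xpredT) (F := fun i => u 0 i * u 0 i)) => // j _.
  by rewrite -expr2 sqr_ge0.
by move=> /eqP; rewrite mulf_eq0 orbb.
Qed.

Lemma dot_delta u i : dot u (delta_mx 0 i) = u 0 i.
Proof.
rewrite /dot (bigD1 i)//= mxE !eqxx mulr1 big1 ?addr0// => j ji.
by rewrite mxE (negPf ji) mulr0.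
Qed.

Lemma differentiable_dot (V : normedModType R) (f g : V -> E) (x : V) :
  differentiable f x -> differentiable g x ->
  differentiable (fun z => dot (f z) (g z)) x.
Proof.
move=> df dg.
have -> : (fun z => dot (f z) (g z)) =
    \sum_(i < n.+1) ((fun z => f z 0 i) * (fun z => g z 0 i)).
  by apply/funext => y; rewrite fct_sumE.
by apply: differentiable_sum => i; apply: differentiableM;
  exact: differentiable_comp_coord.
Qed.

Lemma derive_dot (V : normedModType R) (f g : V -> E) (x v : V) :
  differentiable f x -> differentiable g x ->
  'D_v (fun z => dot (f z) (g z)) x =
  dot ('D_v f x) (g x) + dot (f x) ('D_v g x).
Proof.
move=> df dg.
have dfi i := @differentiable_comp_coord _ _ _ _ _ i df.
have dgi i := @differentiable_comp_coord _ _ _ _ _ i dg.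
have -> : (fun z => dot (f z) (g z)) =
    \sum_(i < n.+1) ((fun z => f z 0 i) * (fun z => g z 0 i)).
  by apply/funext => y; rewrite fct_sumE.
rewrite derive_sum => [|i]; last first.
  by apply: diff_derivable; exact: differentiableM.
rewrite /dot -big_split; apply: eq_bigr => i _ /=.
rewrite deriveM; [|exact: diff_derivable..].
rewrite !derive_coord; [|exact: diff_derivable..].
by rewrite addrC /GRing.scale/= (mulrC (g x 0 i)).
Qed.

End Dot.

(** * The retraction onto the sphere *)

Section Retraction.
Context {R : realType} {n : nat}.
Local Notation E := 'rV[R]_n.+1.
Implicit Types u v w x y p : E.

Lemma sphereP p : sphere R n p -> dot p p = 1. Proof. by []. Qed.

Lemma retr_id p : sphere R n p -> retr p = p.
Proof. by move=> /sphereP p1; rewrite /retr p1 sqrtr1 invr1 scale1r. Qed.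

Lemma retr_sphere y : 0 < dot y y -> sphere R n (retr y).
Proof.
move=> y0; rewrite /sphere/= /retr dotZl dotZr mulrA -invfM -expr2.
by rewrite sqr_sqrtr ?mulVf ?gt_eqF ?ltW.
Qed.

Lemma differentiable_norm2 p : differentiable (fun y : E => dot y y) p.
Proof. by apply: differentiable_dot. Qed.

Lemma near_dot_gt0 p : 0 < dot p p -> \forall y \near p, 0 < dot y y.
Proof.
move=> p0; have c := differentiable_continuous (differentiable_norm2 p).
exact: (c _ (lt_nbhsr p0)).
Qed.

Lemma differentiable_inv_norm p : 0 < dot p p ->
  differentiable (fun y : E => (Num.sqrt (dot y y))^-1) p.
Proof.
move=> p0; apply: (@differentiableV R E (fun y => Num.sqrt (dot y y)));
  last by rewrite gt_eqF// sqrtr_gt0.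
have dsqrt : differentiable (Num.sqrt : R -> R) (dot p p).
  by apply/derivable1_diffP; have [] := is_derive1_sqrt p0.
exact: (differentiable_comp (differentiable_norm2 p) dsqrt).
Qed.

Lemma differentiable_retr p : 0 < dot p p -> differentiable (retr : E -> E) p.
Proof.
move=> p0; apply: differentiable_row => i.
have -> : (fun y : E => retr y 0 i) =
    (fun y : E => (Num.sqrt (dot y y))^-1) * (fun y => y 0 i).
  by apply/funext => y; rewrite /retr mxE.
apply: differentiableM; first exact: differentiable_inv_norm.
exact: differentiable_coord.
Qed.

(** The derivative of y |-> |y|^-1 y along [v] is [v] plus a multiple of [p]. As
the retraction takes values in the sphere, it is also orthogonal to [p], hence
the multiple is zero: the norm never has to be differentiated explicitly. *)
Lemma derive_retr p v : sphere R n p -> dot v p = 0 ->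
  'D_v (retr : E -> E) p = v.
Proof.
move=> p1 vp; have p0 : 0 < dot p p by rewrite sphereP.
have dretr := differentiable_retr p0.
pose k (y : E) : R := (Num.sqrt (dot y y))^-1.
have dk : differentiable k p by exact: differentiable_inv_norm.
have kp : k p = 1 by rewrite /k sphereP// sqrtr1 invr1.
have w_eq : 'D_v (retr : E -> E) p = v + 'D_v k p *: p.
  apply/rowP => i; rewrite -derive_coord; last exact: diff_derivable.
  have -> : (fun y : E => retr y 0 i) = k * (fun y => y 0 i).
    by apply/funext => y; rewrite /retr mxE.
  have dcoord : differentiable (fun y : E => y 0 i) p.
    exact: differentiable_coord.
  rewrite deriveM; [|exact: diff_derivable..].
  rewrite kp derive_coord ?derive_id; last exact: derivable_id.
  by rewrite !mxE /GRing.scale/= mul1r (mulrC (p 0 i)).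
have : dot ('D_v (retr : E -> E) p) p = 0.
  have : 'D_v (fun y : E => dot (retr y) (retr y)) p = 0.
    rewrite -[RHS](derive_cst (1 : R^o) p v); apply: near_eq_derive.
    by near=> y; apply: retr_sphere; near: y; exact: near_dot_gt0.
  rewrite derive_dot// retr_id// (dotC p) -mulr2n => /eqP.
  by rewrite mulrn_eq0/= => /eqP.
rewrite w_eq dotDl dotZl vp add0r sphereP// mulr1 => ->.
by rewrite scale0r addr0.
Unshelve. all: by end_near. Qed.

(** The form in which identities that hold on the sphere only are transported to
a full ambient neighborhood, where they can be differentiated. *)
Lemma near_retr p (W : set E) : open W -> sphere R n p -> W p ->
  \forall y \near p, (sphere R n `&` W) (retr y).
Proof.
move=> oW p1 Wp; have p0 : 0 < dot p p by rewrite sphereP.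
near=> y; split; first by apply: retr_sphere; near: y; exact: near_dot_gt0.
near: y; apply: (differentiable_continuous (differentiable_retr p0)).
by rewrite retr_id//; exact: open_nbhs_nbhs.
Unshelve. all: by end_near. Qed.

Section TangentDerive.
Context {V : normedModType R}.
Implicit Types F g : E -> V.

(** The derivative along the curve (p + t v) / |p + t v| of the sphere is the
ordinary directional derivative of any ambient extension, by the chain rule and
[derive_retr]. *)
Lemma tangent_deriveE F g p v (W : set E) : open W -> W p ->
  sphere R n p -> (forall x, (sphere R n `&` W) x -> F x = g x) ->
  differentiable g p -> dot v p = 0 -> tangent_derive F p v = 'D_v g p.
Proof.
move=> oW Wp p1 Fg dg vp; have p0 : 0 < dot p p by rewrite sphereP.
have dretr := differentiable_retr p0.
rewrite /tangent_derive (near_eq_derive (g := g \o retr)); last first.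
  have := near_retr oW p1 Wp.
  by apply: filterS => y /Fg.
rewrite deriveE; last by apply: differentiable_comp => //; rewrite retr_id.
rewrite diff_comp//=; last by rewrite retr_id.
by rewrite -(deriveE v dretr) derive_retr// retr_id// deriveE.
Qed.

End TangentDerive.

End Retraction.

(** * The Hessian of the restriction of an ambient function *)

Section HessianOfExtension.
Context {R : realType} {n : nat}.
Local Notation E := 'rV[R]_n.+1.
Variables (W : set E) (F g : E -> R) (X Y : E -> E) (p : E).
Hypotheses (oW : open W) (Wp : W p) (Sp : sphere R n p).
Hypotheses (C2g : Ck 2 W (g : E -> R^o))
  (dY : forall x, W x -> differentiable Y x).
Hypotheses (Fg : forall x, (sphere R n `&` W) x -> F x = g x)
  (XY : forall x, (sphere R n `&` W) x -> X x = Y x)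
  (X_tangent : forall x, (sphere R n `&` W) x -> dot (X x) x = 0).

Let dg x : W x -> differentiable (g : E -> R^o) x.
Proof. exact: (C2g.1). Qed.

Let ddg v x : W x -> differentiable ('D_v (g : E -> R^o)) x.
Proof. exact: ((C2g.2 v).1). Qed.

(* The extension y |-> D_(Y y) g of the function X F. The coordinates separate
   the dependence on the base point from the dependence on the direction. *)
Let Dg_Y (y : E) : R :=
  \sum_(i < n.+1) Y y 0 i * 'D_(delta_mx 0 i) (g : E -> R^o) y.

Let derive_sum_coord x v : W x ->
  'D_v (g : E -> R^o) x =
  \sum_(i < n.+1) v 0 i * 'D_(delta_mx 0 i) (g : E -> R^o) x.
Proof.
move=> Wx; rewrite {1}[v]row_sum_delta deriveE ?linear_sum; last exact: dg.
by apply: eq_bigr => i _; rewrite linearZ -deriveE//; exact: dg.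
Qed.

Let Dg_YE : Dg_Y =
  \sum_(i < n.+1) ((fun y => Y y 0 i) * 'D_(delta_mx 0 i) (g : E -> R^o)).
Proof. by apply/funext => y; rewrite fct_sumE. Qed.

Let differentiable_Dg_Y : differentiable (Dg_Y : E -> R^o) p.
Proof.
rewrite Dg_YE; apply: differentiable_sum => i; apply: differentiableM.
  by apply: differentiable_comp_coord; exact: dY.
exact: ddg.
Qed.

Let derive_Dg_Y v : 'D_v (Dg_Y : E -> R^o) p =
  'D_('D_v Y p) (g : E -> R^o) p + 'D_v ('D_(Y p) (g : E -> R^o)) p.
Proof.
have dYi i : differentiable (fun y => Y y 0 i) p.
  by apply: differentiable_comp_coord; exact: dY.
rewrite Dg_YE derive_sum => [|i]; last first.
  by apply: diff_derivable; apply: differentiableM => //; exact: ddg.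
have -> : 'D_v ('D_(Y p) (g : E -> R^o)) p = 'D_v (\sum_(i < n.+1)
    (Y p 0 i *: 'D_(delta_mx 0 i) (g : E -> R^o))) p.
  apply: near_eq_derive; near=> y; rewrite fct_sumE.
  by apply: derive_sum_coord; near: y; exact: open_nbhs_nbhs.
rewrite derive_sum => [|i]; last first.
  by apply: diff_derivable; apply: differentiableZ; exact: ddg.
rewrite derive_sum_coord// -big_split; apply: eq_bigr => i _ /=.
rewrite deriveM; [|exact: diff_derivable|exact/diff_derivable/ddg].
rewrite deriveZ; last exact/diff_derivable/ddg.
rewrite derive_coord; last exact/diff_derivable/dY.
by rewrite addrC /GRing.scale/= (mulrC ('D_v Y p 0 i)).
Unshelve. all: by end_near. Qed.

Let nabla_funE x : (sphere R n `&` W) x -> nabla_fun X F x = Dg_Y x.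
Proof.
move=> -[Sx Wx]; rewrite /nabla_fun.
rewrite (tangent_deriveE (g := g : E -> R^o) oW Wx)//; last 2 first.
- exact: dg.
- exact: X_tangent.
by rewrite derive_sum_coord// XY.
Qed.

Let near_nabla_fun_retr :
  \forall y \near p, Dg_Y (retr y) = (nabla_fun X F \o retr) y.
Proof. by apply: filterS (near_retr oW Sp Wp) => y /nabla_funE. Qed.

Let differentiable_Dg_Y_retr : differentiable (Dg_Y \o retr : E -> R^o) p.
Proof.
apply: differentiable_comp; last by rewrite retr_id.
by apply: differentiable_retr; rewrite sphereP.
Qed.

(** Gives the continuity of X F along a geodesic, which is needed to find a
maximum. *)
Lemma differentiable_nabla_fun :
  differentiable (nabla_fun X F \o retr : E -> R^o) p.
Proof.
exact: near_eq_differentiable near_nabla_fun_retr differentiable_Dg_Y_retr.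
Qed.

(** Differentiate <X, x> = 0 along the sphere: the normal component of the
ambient derivative of a tangent field is given by the second fundamental
form. *)
Lemma dot_derive_tangent : dot ('D_(X p) Y p) p = - dot (X p) (X p).
Proof.
have Xp := X_tangent (conj Sp Wp).
have dretr : differentiable (retr : E -> E) p.
  by apply: differentiable_retr; rewrite sphereP.
have dYr : differentiable (Y \o retr) p.
  by apply: differentiable_comp => //; rewrite retr_id//; exact: dY.
have : 'D_(X p) (fun y => dot ((Y \o retr) y) (retr y)) p = 0.
  rewrite -[RHS](derive_cst (0 : R^o) p (X p)); apply: near_eq_derive.
  apply: filterS (near_retr oW Sp Wp) => y Wy.
  by rewrite /= -XY// X_tangent.
rewrite derive_dot//= derive_retr// retr_id// -XY//.
rewrite -/(tangent_derive Y p (X p)) (tangent_deriveE (g := Y) oW Wp)//.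
  by move=> /eqP; rewrite addr_eq0 => /eqP.
exact: dY.
Qed.

(** With w = D_X Y, one has X (X F) = D^2 g (X, X) + D_w g, while nabla_X X is
the tangential part of w, so that the two terms D_w g cancel. What remains is
the derivative of g along the normal part of w, by [dot_derive_tangent]. *)
Theorem Hess_extension : Hess F X p =
  'D_(X p) ('D_(X p) (g : E -> R^o)) p
  - dot (X p) (X p) * 'D_p (g : E -> R^o) p.
Proof.
have SWp : (sphere R n `&` W) p by [].
have Xp := X_tangent SWp.
have -> : Hess F X p = tangent_derive (nabla_fun X F : E -> R^o) p (X p)
    - tangent_derive (F : E -> R^o) p
        (tangent_proj p (tangent_derive X p (X p))) by [].
rewrite (tangent_deriveE (g := Dg_Y : E -> R^o) oW Wp)//.
rewrite (tangent_deriveE (g := Y) oW Wp)//; last exact: dY.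
rewrite (tangent_deriveE (g := g : E -> R^o) oW Wp)//; last 2 first.
- exact: dg.
- by rewrite /tangent_proj dotDl dotNl dotZl sphereP// mulr1 subrr.
rewrite derive_Dg_Y -XY// /tangent_proj dot_derive_tangent scaleNr opprK.
rewrite deriveDl ?deriveZl; [|exact: dg..].
by rewrite /GRing.scale/= opprD addrACA subrr add0r.
Qed.

End HessianOfExtension.

(** * C^k maps *)

Section Ck.
Context {R : realType} {n : nat}.
Local Notation E := 'rV[R]_n.+1.
Context {V : normedModType R}.
Implicit Types (f : E -> V) (W : set E).

Lemma Ck_subset k W W' f : W' `<=` W -> Ck k W f -> Ck k W' f.
Proof.
move=> W'W; elim: k f => [|k IHk] f /=; first by move=> cf x /W'W/cf.
by move=> [df ckf]; split=> [x /W'W/df//|v]; exact: IHk.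
Qed.

Lemma Ck_cst k W (c : V) : Ck k W (cst c : E -> V).
Proof.
elim: k c => [|k IHk] c /=; first by move=> x _; exact: cst_continuous.
split=> // v; have -> : 'D_v (cst c : E -> V) = cst 0; last exact: IHk.
by apply/funext => x; rewrite derive_cst.
Qed.

Lemma derive_linear f x v : linear f -> continuous f -> 'D_v f x = f v.
Proof.
move=> lf cf; pose fM := GRing.isLinear.Build _ _ _ _ _ lf.
pose fL : {linear E -> V} := HB.pack f fM.
rewrite deriveE; first by rewrite (@diff_lin _ _ _ fL).
exact: (@linear_differentiable _ _ _ fL).
Qed.

Lemma Ck_linear k W f : linear f -> continuous f -> Ck k W f.
Proof.
move=> lf cf; pose fM := GRing.isLinear.Build _ _ _ _ _ lf.
pose fL : {linear E -> V} := HB.pack f fM.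
case: k => [|k] /=; first by move=> x _; exact: cf.
split=> [x _|v]; first exact: (@linear_differentiable _ _ _ fL).
have -> : 'D_v f = cst (f v); last exact: Ck_cst.
by apply/funext => x; rewrite derive_linear.
Qed.

End Ck.

Section ConvexFunctions.
Context {R : realType} {n : nat}.
Local Notation E := 'rV[R]_n.+1.

(** Common local data for [Hess_extension]: the neighborhoods on which the
domain is described and on which F and X extend are shrunk to a single one. *)
Lemma local_extensions (U : set E) (F : E -> R) X p :
  sphere_open U -> U p -> sphere_Ck 2 U (F : E -> R^o) ->
  smooth_vector_field U X ->
  exists (W : set E) (g : E -> R) (Y : E -> E),
    [/\ open W, W p, Ck 2 W (g : E -> R^o),
        (forall x, W x -> differentiable Y x) &
        forall x, (sphere R n `&` W) x ->
        [/\ U x, F x = g x, X x = Y x & dot (X x) x = 0]].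
Proof.
move=> [W0 oW0 UE] Up /(_ p Up)[W1 [g [oW1 W1p C2g gF]]].
move=> [/(_ 1%N p Up)[W2 [Y [oW2 W2p C1Y YX]]] Xt].
exists (W0 `&` W1 `&` W2), g, Y; split.
- by apply: openI => //; exact: openI.
- by do !split => //; move: Up; rewrite UE => -[].
- by apply: Ck_subset C2g => x [[]].
- by move=> x [_ W2x]; exact: C1Y.1.
- move=> x [Sx [[W0x W1x] W2x]].
  have Ux : U x by rewrite UE.
  by split=> //; [rewrite gF|rewrite YX|exact: Xt].
Qed.

End ConvexFunctions.

(** * Great circles carry no strictly convex function *)

Section Compactness.
Context {R : realType} {n : nat}.
Local Notation E := 'rV[R]_n.+1.

Lemma compact_sphere : compact (sphere R n).
Proof.
apply: bounded_closed_compact.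
  exists 1; split => // M M1 x Sx; apply: le_trans (ltW M1).
  rewrite [leLHS]/Num.Def.normr/= mx_normrE (bigmax_le _ ler01)//= => -[i j] _.
  rewrite (ord1 i) -(@ler_pXn2r _ 2)// ?nnegrE// expr1n real_normK ?num_real//.
  rewrite -[leRHS](sphereP Sx) /dot (bigD1 j)//= expr2 lerDl sumr_ge0// => k _.
  by rewrite -expr2 sqr_ge0.
have -> : sphere R n = (fun x => dot x x) @^-1` [set r | r = 1] by [].
apply: closed_comp => [x _|]; last exact: closed_eq.
exact: differentiable_continuous (differentiable_norm2 x).
Qed.

End Compactness.

Section GreatCircles.
Context {R : realType} {n : nat}.
Local Notation E := 'rV[R]_n.+1.

Definition great_circle (a b : E) : set E :=
  sphere R n `&` [set x | x = dot a x *: a + dot b x *: b].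

Variables a b : E.
Hypotheses (a1 : dot a a = 1) (b1 : dot b b = 1) (ab0 : dot a b = 0).

(** The infinitesimal rotation of the plane spanned by [a] and [b]: a linear
Killing field of the sphere, whose restriction to the great circle of that plane
is the unit velocity. *)
Definition rotation_field (x : E) : E := dot a x *: b - dot b x *: a.
Local Notation X := rotation_field.

Let ba0 : dot b a = 0. Proof. by rewrite dotC. Qed.

Lemma differentiable_dotl (c x : E) : differentiable (dot c : E -> R^o) x.
Proof. exact: (differentiable_dot (f := cst c) (g := id)). Qed.

Lemma differentiable_rotation x : differentiable X x.
Proof.
by apply: differentiableB; apply: differentiableZl; exact: differentiable_dotl.
Qed.

Lemma linear_rotation : linear X.
Proof.
move=> s x y; rewrite /X !dotDr !dotZr !scalerDl !scalerBr opprD !scalerA.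
by rewrite addrACA.
Qed.

Lemma continuous_rotation : continuous X.
Proof.
by move=> x; exact: differentiable_continuous (differentiable_rotation x).
Qed.

Lemma dot_rotation x : dot (X x) x = 0.
Proof. by rewrite /X dotDl dotNl !dotZl mulrC subrr. Qed.

Lemma smooth_rotation (U : set E) : smooth_vector_field U X.
Proof.
split=> [k p Up|p _]; last exact: dot_rotation.
exists setT, X; split => //; first exact: openT.
exact: Ck_linear linear_rotation continuous_rotation.
Qed.

Lemma dot_rotation_skew x y : dot (X x) y = - dot x (X y).
Proof.
rewrite /X (dotC x) !dotDl !dotNl !dotZl; ring.
Qed.

Lemma dotl_rotation x : dot a (X x) = - dot b x.
Proof.
by rewrite dotC /X dotDl dotNl !dotZl a1 ba0 mulr0 mulr1 add0r.
Qed.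

Lemma dotr_rotation x : dot b (X x) = dot a x.
Proof.
by rewrite dotC /X dotDl dotNl !dotZl b1 ab0 mulr0 mulr1 subr0.
Qed.

(** The rotation field restricted to the great circle has purely normal
acceleration, so that the great circle is a geodesic. *)
Lemma rotationK x : great_circle a b x -> X (X x) = - x.
Proof.
move=> [_ xE]; rewrite {1}/X dotl_rotation dotr_rotation [in RHS]xE.
by rewrite scaleNr opprD addrC.
Qed.

Lemma great_circle_retr x : great_circle a b x -> forall s : R,
  great_circle a b (retr (s *: X x + x)).
Proof.
move=> [Sx xE] s; have y1 : 0 < dot (s *: X x + x) (s *: X x + x).
  rewrite !dotDl !dotDr !dotZl !dotZr (dotC x) dot_rotation (sphereP Sx).
  rewrite !mulr0 addr0 add0r ltr_wpDl// mulrA -expr2 mulr_ge0// ?sqr_ge0//.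
  exact: dot_ge0.
split; first exact: retr_sphere.
set y := s *: X x + x; have yE : y = dot a y *: a + dot b y *: b.
  rewrite /y !dotDr !dotZr dotl_rotation dotr_rotation.
  rewrite !scalerDl addrACA -xE mulrN scaleNr -!scalerA -scalerN -scalerDr.
  by congr (s *: _ + x); rewrite addrC.
rewrite /= /retr; set c := _^-1.
by rewrite !dotZr -!scalerA -scalerDr -yE.
Qed.

Lemma compact_great_circle : compact (great_circle a b).
Proof.
apply: compact_closedI; first exact: compact_sphere.
have -> : [set x | x = dot a x *: a + dot b x *: b] =
    (fun x => x - (dot a x *: a + dot b x *: b)) @^-1` [set 0].
  apply/seteqP; split => x /= xE; apply/eqP.
    by rewrite subr_eq0; apply/eqP.
  by rewrite -subr_eq0; apply/eqP.
apply: closed_comp => [x _|]; last first.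
  exact/accessible_closed_set1/hausdorff_accessible/norm_hausdorff.
apply: differentiable_continuous; apply: differentiableB => //.
by apply: differentiableD; apply: differentiableZl; exact: differentiable_dotl.
Qed.

(** Let h = X F for the rotation field X. Since nabla_X X = 0 on the great
circle, Hess F (X, X) is there the derivative of h along the circle; but it is
not positive at a point where h is maximal on the compact circle. *)
Theorem no_strictly_convex_great_circle (U : set E) (F : E -> R) :
  sphere_open U -> great_circle a b `<=` U -> ~ strictly_convex U F.
Proof.
move=> oU KU [C2F Fconvex].
pose h := nabla_fun X F \o retr.
have dh p : great_circle a b p -> differentiable (h : E -> R^o) p.
  move=> Kp; have Up := KU _ Kp.
  have [W [g [Y [oW Wp C2g dY loc]]]] :=
    local_extensions oU Up C2F (smooth_rotation U).
  by apply: (differentiable_nabla_fun oW Wp _ C2g dY);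
    [case: Kp|move=> x /loc[]..].
have [p Kp pmax] : exists2 p, p \in great_circle a b &
    forall x, x \in great_circle a b -> h x <= h p.
  apply: EVT_max_rV; last 1 first.
  - apply: continuous_in_subspaceT => x /set_mem Kx.
    exact: differentiable_continuous (dh x Kx).
  - exists a; split => //=.
    by rewrite a1 ba0 scale1r scale0r addr0.
  - exact: compact_great_circle.
have {}Kp := set_mem Kp.
have Xp : dot (X p) (X p) = 1.
  by rewrite dot_rotation_skew rotationK// dotC dotNl opprK sphereP//; case: Kp.
have Xp0 : X p != 0.
  apply/eqP => Xp0; move: Xp; rewrite Xp0 -(scale0r 0) dotZl mul0r => /eqP.
  by rewrite eq_sym oner_eq0.
have Up := KU _ Kp.
have := Fconvex X (smooth_rotation U) p Up Xp0.
have -> : Hess F X p = 'D_(X p) (h : E -> R^o) p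
    - tangent_derive (F : E -> R^o) p (nabla X X p) by [].
have -> : nabla X X p = 0.
  rewrite /nabla (tangent_deriveE (g := X) openT)//; last 3 first.
  - by case: Kp.
  - exact: differentiable_rotation.
  - exact: dot_rotation.
  rewrite derive_linear; [|exact: linear_rotation|exact: continuous_rotation].
  rewrite rotationK// /tangent_proj dotNl sphereP; last by case: Kp.
  by rewrite scaleN1r opprK addNr.
rewrite /tangent_derive derive0 subr0 ltNge => /negP; apply.
apply: derive_le0_of_max; first exact: diff_derivable (dh p Kp).
move=> s; have Ks := great_circle_retr Kp s.
(* The function h is defined through the retraction, so moving along the
   tangent line is the same as moving along the circle. *)
have -> : h (s *: X p + p) = h (retr (s *: X p + p)).
  by rewrite /h/= (retr_id Ks.1).
by apply: pmax; rewrite inE.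
Qed.

End GreatCircles.

(** * Differentials of expressions and stability of C^k *)

Section DiffRules.
Context {R : realType} {V : normedModType R}.
Implicit Types (f g : V -> R^o) (x v : V).

Lemma is_diff_derive (W : normedModType R) (f df : V -> W) x v :
  is_diff x f df -> 'D_v f x = df v.
Proof. by move=> fdf; rewrite deriveE// diff_val. Qed.

Lemma is_diff_add f g x (df dg : V -> R^o) :
  is_diff x f df -> is_diff x g dg ->
  is_diff x (fun y => f y + g y : R^o) (fun v => df v + dg v).
Proof. by move=> fdf gdg; apply: is_diffD. Qed.

Lemma is_diff_mul f g x (df dg : V -> R^o) :
  is_diff x f df -> is_diff x g dg ->
  is_diff x (fun y => f y * g y : R^o) (fun v => df v * g x + f x * dg v).
Proof.
move=> fdf gdg; apply: is_diff_eq (is_diffM fdf gdg) _.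
by apply/funext => v; rewrite !fctE addrC /GRing.scale/= (mulrC (g x)).
Qed.

Lemma is_diff_cmul c f x (df : V -> R^o) :
  is_diff x f df -> is_diff x (fun y => c * f y : R^o) (fun v => c * df v).
Proof. by move=> fdf; exact: (is_diffZ c fdf). Qed.

Lemma is_diff_comp1 (h : R -> R) f x (df : V -> R^o) dh :
  is_diff x f df -> is_derive (f x) 1 (h : R -> R^o) dh ->
  is_diff x (fun y => h (f y) : R^o) (fun v => dh * df v).
Proof.
move=> fdf [hd hv].
have dh1 : differentiable (h : R -> R^o) (f x) by apply/derivable1_diffP.
have hdiff : is_diff (f x) (h : R -> R^o) (fun t => t * dh).
  apply: DiffDef => //; rewrite diff1E//; apply/funext => t.
  by rewrite derive1E hv.
apply: is_diff_eq (is_diff_comp fdf hdiff) _.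
by apply/funext => v /=; rewrite mulrC.
Qed.

Lemma is_diff_inv f x (df : V -> R^o) : f x != 0 -> is_diff x f df ->
  is_diff x (fun y => (f y)^-1 : R^o) (fun v => - (f x)^-1 ^+ 2 * df v).
Proof.
move=> fx0 fdf; apply: DiffDef; first exact: differentiableV.
by rewrite diffV// diff_val exprVn.
Qed.

End DiffRules.

Section CkClosure.
Context {R : realType} {n : nat}.
Local Notation E := 'rV[R]_n.+1.
Variable W : set E.
Hypothesis oW : open W.
Implicit Types f g : E -> R^o.

Lemma Ck_eq (V : normedModType R) k (f g : E -> V) :
  (forall x, W x -> f x = g x) -> Ck k W f -> Ck k W g.
Proof.
have nearW (f1 g1 : E -> V) x : (forall x, W x -> f1 x = g1 x) -> W x ->
    \near x, f1 x = g1 x.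
  by move=> fg Wx; near=> y; apply: fg; near: y; exact: open_nbhs_nbhs.
elim: k f g => [|k IHk] f g fg /=.
  move=> cf x Wx; have : f y @[y --> x] --> f x := cf x Wx.
  rewrite fg//; apply: cvg_trans; exact: near_eq_cvg (nearW f g x fg Wx).
move=> [df ckf]; split=> [x Wx|v].
  exact: near_eq_differentiable (nearW f g x fg Wx) (df x Wx).
apply: IHk (ckf v) => x Wx; exact: near_eq_derive (nearW f g x fg Wx).
Unshelve. all: by end_near. Qed.

Lemma Ck_S (V : normedModType R) k (f : E -> V) : Ck k.+1 W f -> Ck k W f.
Proof.
elim: k f => [|k IHk] f [df ckf].
  by move=> x Wx; exact: differentiable_continuous (df x Wx).
by split => // v; apply: IHk; exact: ckf.
Qed.

Lemma Ck_add k f g : Ck k W f -> Ck k W g -> Ck k W (fun x => f x + g x : R^o).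
Proof.
elim: k f g => [|k IHk] f g /=.
  by move=> cf cg x Wx; exact: continuousD (cf x Wx) (cg x Wx).
move=> [df ckf] [dg ckg]; split=> [x Wx|v].
  by apply: differentiableD; [exact: df|exact: dg].
apply: Ck_eq (IHk _ _ (ckf v) (ckg v)) => x Wx.
by rewrite -deriveD//; apply: diff_derivable; [exact: df|exact: dg].
Qed.

Lemma Ck_mul k f g : Ck k W f -> Ck k W g -> Ck k W (fun x => f x * g x : R^o).
Proof.
elim: k f g => [|k IHk] f g.
  by move=> cf cg x Wx; exact: continuousM (cf x Wx) (cg x Wx).
move=> Cf Cg; have [df ckf] := Cf; have [dg ckg] := Cg; split=> [x Wx|v].
  by apply: differentiableM; [exact: df|exact: dg].
have := Ck_add (IHk _ _ (ckf v) (Ck_S Cg)) (IHk _ _ (Ck_S Cf) (ckg v)).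
apply: Ck_eq => x Wx.
by rewrite (is_diff_derive _ (is_diff_mul (differentiableP (df x Wx))
  (differentiableP (dg x Wx)))) -!deriveE//; [exact: dg|exact: df].
Qed.

(** By induction: D_v (1 / f) = - (1 / f)^2 D_v f involves 1 / f at the
previous order only. *)
Lemma Ck_inv k f : (forall x, W x -> f x != 0) -> Ck k W f ->
  Ck k W (fun x => (f x)^-1 : R^o).
Proof.
move=> f0; elim: k => [|k IHk] Cf.
  by move=> x Wx; exact: continuousV (f0 x Wx) (Cf x Wx).
have [df ckf] := Cf; split=> [x Wx|v].
  by apply: differentiableV; [exact: df|exact: f0].
have Cinv := IHk (Ck_S Cf).
have := Ck_mul (Ck_mul (Ck_cst k W (-1 : R^o)) (Ck_mul Cinv Cinv)) (ckf v).
apply: Ck_eq => x Wx.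
rewrite (is_diff_derive _ (is_diff_inv (f0 x Wx) (differentiableP (df x Wx)))).
by rewrite -deriveE ?mulN1r ?expr2//; exact: df.
Qed.

(** As for [Ck_inv], with D_v (exp f) = exp f * D_v f. *)
Lemma Ck_expR k f : Ck k W f -> Ck k W (fun x => expR (f x) : R^o).
Proof.
have dexp f1 x : differentiable f1 x ->
    is_diff x (fun y => expR (f1 y) : R^o) (fun v => expR (f1 x) * 'd f1 x v).
  by move=> /differentiableP df1; apply: is_diff_comp1 df1 _.
elim: k => [|k IHk] Cf.
  by move=> x Wx; apply: (continuous_comp (Cf x Wx)); exact: continuous_expR.
have [df ckf] := Cf; split=> [x Wx|v]; first by have [] := dexp _ _ (df x Wx).
apply: Ck_eq (Ck_mul (IHk (Ck_S Cf)) (ckf v)) => x Wx.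
by rewrite (is_diff_derive _ (dexp _ _ (df x Wx))) -deriveE//; exact: df.
Qed.

Lemma Ck_coord k i : Ck k W (fun x => x 0 i : R^o).
Proof.
apply: Ck_linear; first by move=> a x y; rewrite !mxE.
exact: coord_continuous.
Qed.

End CkClosure.

(** * The angle around a codimension-two axis *)

Section Angle.
Context {R : realType} {n : nat}.
Local Notation E := 'rV[R]_n.+1.
Variables i j : 'I_n.+1.
Implicit Types x v w : E.

Definition axis_sqdist x : R := x 0 i * x 0 i + x 0 j * x 0 j.

(** The angle phi with x_i = r sin phi, x_j = - r cos phi, as twice the
arctangent of tan (phi / 2) = x_i / (r - x_j). This formula is smooth on the
whole plane minus the closed ray x_i = 0 <= x_j, which is where r = x_j. *)
Definition angle x : R := 2 * atan (x 0 i / (Num.sqrt (axis_sqdist x) - x 0 j)).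

Lemma is_diff_coord x k : is_diff x (fun y => y 0 k : R^o) (fun v => v 0 k).
Proof.
have dk : differentiable (fun y : E => y 0 k : R^o) x.
  exact: differentiable_coord.
apply: DiffDef => //; apply/funext => v.
by rewrite -deriveE// (derive_coord (f := id)) ?derive_id.
Qed.

Lemma is_diff_axis_sqdist x :
  is_diff x (axis_sqdist : E -> R^o)
    (fun v => 2 * (x 0 i * v 0 i + x 0 j * v 0 j)).
Proof.
have dx := is_diff_coord x.
apply: is_diff_eq (is_diff_add (is_diff_mul (dx i) (dx i))
  (is_diff_mul (dx j) (dx j))) _.
by apply/funext => v; ring.
Qed.

Lemma axis_sqdist_ge0 x : 0 <= axis_sqdist x.
Proof. by rewrite /axis_sqdist -!expr2 addr_ge0// sqr_ge0. Qed.

Lemma axis_sqdist_gt0 x : x 0 j < Num.sqrt (axis_sqdist x) -> 0 < axis_sqdist x.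
Proof.
move=> xj; rewrite lt_neqAle axis_sqdist_ge0 andbT eq_sym; apply/eqP => q0.
move: xj; rewrite q0 sqrtr0 => xj.
suff : 0 < axis_sqdist x by rewrite q0 ltxx.
by rewrite /axis_sqdist -!expr2 ltr_wpDl ?sqr_ge0// exprn_even_gt0//= lt_eqF.
Qed.

(* The derivative of [angle], with (a, b) the point, (c, d) the direction and r
   the norm of (a, b); after clearing denominators it follows from
   a^2 = r^2 - b^2. *)
Let half_angle_identity (a b c d r : R) : r != 0 -> r - b != 0 ->
  r ^+ 2 = a * a + b * b ->
  2 * ((1 + (a / (r - b)) ^+ 2)^-1 *
    (c * (r - b)^-1 + a * (- (r - b)^-1 ^+ 2 *
      ((2 * r)^-1 * (2 * (a * c + b * d)) + -1 * d)))) =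
  (a * d - b * c) / (a * a + b * b).
Proof.
move=> r0 rb0 rE; have aE : a * a = r ^+ 2 - b * b by rewrite rE addrK.
rewrite -rE.
have -> : 1 + (a / (r - b)) ^+ 2 = 2 * r / (r - b).
  by rewrite expr2 mulrACA aE; field.
have -> : c * (r - b)^-1 + a * (- (r - b)^-1 ^+ 2 *
      ((2 * r)^-1 * (2 * (a * c + b * d)) + -1 * d)) =
  (c * (r ^+ 2 - b * b - a * a) + (r - b) * (a * d - b * c))
    / ((r - b) ^+ 2 * r).
  by field; rewrite r0 rb0.
by rewrite aE; field; rewrite r0 rb0.
Qed.

(** The closed one-form (x_i dx_j - x_j dx_i) / r^2: away from here the
arctangent never appears, and all computations are rational. *)
Lemma is_diff_angle x : x 0 j < Num.sqrt (axis_sqdist x) ->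
  is_diff x (angle : E -> R^o)
    (fun v => (x 0 i * v 0 j - x 0 j * v 0 i) / axis_sqdist x).
Proof.
move=> xj; have q0 := axis_sqdist_gt0 xj.
have dx := is_diff_coord x.
have dr := is_diff_comp1 (is_diff_axis_sqdist x) (is_derive1_sqrt q0).
have dden := is_diff_add dr (is_diff_cmul (-1) (dx j)).
have den0 : Num.sqrt (axis_sqdist x) - x 0 j != 0 by rewrite subr_eq0 gt_eqF.
have den0' : Num.sqrt (axis_sqdist x) + -1 * x 0 j != 0 by rewrite mulN1r.
pose den (y : E) : R^o := Num.sqrt (axis_sqdist y) + -1 * y 0 j.
have dtan := is_diff_mul (dx i) (is_diff_inv (f := den) den0' dden).
have := is_diff_cmul 2 (is_diff_comp1 dtan (is_derive1_atan _)).
have -> : (fun y : E => 2 * atan (y 0 i *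
    (Num.sqrt (axis_sqdist y) + -1 * y 0 j)^-1) : R^o) = angle.
  by apply/funext => y; rewrite /angle mulN1r.
move=> dangle; apply: is_diff_eq dangle _; apply/funext => v.
rewrite /den mulN1r half_angle_identity//; first by rewrite gt_eqF// sqrtr_gt0.
by rewrite sqr_sqrtr// ltW.
Qed.

End Angle.

(** * The tilted angle *)

Section ConvexFunction.
Context {R : realType} {n : nat}.
Local Notation E := 'rV[R]_n.+1.
Variables i j : 'I_n.+1.
Implicit Types x v w : E.
Local Notation q := (axis_sqdist i j).

(** The second condition excludes exactly the slit x_i = 0 <= x_j, across which
the angle jumps. *)
Definition slit_region (m : R) : set E :=
  [set x : E | m < q x] `&` [set x : E | x 0 j < Num.sqrt (q x)].

(** For a function f (r), the Hessian of phi + eps f restricted to the kernel of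
its differential is, to first order in eps,
eps ((f'' + 2 f' / r) dr^2 - r f' |v|^2), the term 2 f' / r coming from
Hess phi = - (2 / r) dr dphi. It is positive as soon as f' < 0 and
f'' + 2 f' / r >= 0, and f = r ^- 2 is a rational solution of these
inequalities. *)
Definition tilted_angle (eps : R) (x : E) : R := angle i j x + eps * (q x)^-1.

(** Written with sums, products and one inverse, the operations under which C^k
functions are shown to be stable. *)
Definition dtilted_angle (eps : R) (v x : E) : R :=
  (x 0 i * v 0 j + -1 * v 0 i * x 0 j) * (q x)^-1
  + -2 * eps * (x 0 i * v 0 i + x 0 j * v 0 j) * ((q x)^-1 * (q x)^-1).

Lemma continuous_axis_sqdist : continuous (q : E -> R).
Proof.
move=> x; apply: differentiable_continuous.
by have [] := is_diff_axis_sqdist i j x.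
Qed.

Lemma open_slit_region m : open (slit_region m).
Proof.
apply: openI.
  apply: (open_comp (f := q) (D := [set r | m < r])); last exact: open_gt.
  by move=> x _; exact: continuous_axis_sqdist.
have -> : [set x : E | x 0 j < Num.sqrt (q x)] =
    (fun x => Num.sqrt (q x) - x 0 j) @^-1` [set r | 0 < r].
  by apply/seteqP; split => x /=; rewrite subr_gt0.
apply: open_comp; last exact: open_gt.
move=> x _; apply: (@continuousB R R^o E); last exact: coord_continuous.
apply: (@continuous_comp _ _ _ q Num.sqrt); first exact: continuous_axis_sqdist.
exact: sqrt_continuous.
Qed.

Lemma is_diff_tilted_angle eps x : x 0 j < Num.sqrt (q x) ->
  is_diff x (tilted_angle eps : E -> R^o) (fun v => dtilted_angle eps v x).
Proof.
move=> xj; have q0 : q x != 0 by rewrite gt_eqF// axis_sqdist_gt0.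
have := is_diff_add (is_diff_angle xj)
  (is_diff_cmul eps (is_diff_inv q0 (is_diff_axis_sqdist i j x))).
move=> ds; apply: is_diff_eq ds _.
by apply/funext => v; rewrite /dtilted_angle; field.
Qed.

Lemma Ck_dtilted_angle k eps v (m : R) : 0 <= m ->
  Ck k (slit_region m) (dtilted_angle eps v : E -> R^o).
Proof.
move=> m0; have oW : open (slit_region m) by exact: open_slit_region.
have Cx l := @Ck_coord R n (slit_region m) k l.
have Cc (c : R^o) := Ck_cst k (slit_region m) c.
have Cq : Ck k (slit_region m) (q : E -> R^o).
  by have := Ck_add oW (Ck_mul oW (Cx i) (Cx i)) (Ck_mul oW (Cx j) (Cx j)).
have Cqi : Ck k (slit_region m) (fun x => (q x)^-1 : R^o).
  apply: (Ck_inv oW) => // x [mq _].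
  by rewrite gt_eqF// (le_lt_trans m0).
apply: (Ck_add oW); apply: (Ck_mul oW) => //.
- apply: (Ck_add oW); apply: (Ck_mul oW) => //; exact: Cc.
- apply: (Ck_mul oW); first exact: Cc.
  by apply: (Ck_add oW); apply: (Ck_mul oW) => //; exact: Cc.
- exact: (Ck_mul oW).
Qed.

(** The differential is a rational function, so the arctangent itself does not
have to be differentiated more than once. *)
Lemma Ck_tilted_angle k eps (m : R) : 0 <= m ->
  Ck k.+1 (slit_region m) (tilted_angle eps : E -> R^o).
Proof.
move=> m0; split=> [x [_ xj]|v]; first by case: (is_diff_tilted_angle eps xj).
apply: Ck_eq (Ck_dtilted_angle k eps v m0); first exact: open_slit_region.
by move=> x [_ xj]; rewrite (is_diff_derive _ (is_diff_tilted_angle eps xj)).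
Qed.

Lemma is_diff_dtilted_angle eps v x : x 0 j < Num.sqrt (q x) ->
  is_diff x (dtilted_angle eps v : E -> R^o) (fun w =>
    (w 0 i * v 0 j - v 0 i * w 0 j) / q x
    - 2 * (x 0 i * v 0 j - v 0 i * x 0 j) * (x 0 i * w 0 i + x 0 j * w 0 j)
      / q x ^+ 2
    - 2 * eps * ((w 0 i * v 0 i + w 0 j * v 0 j) / q x ^+ 2
      - 4 * (x 0 i * v 0 i + x 0 j * v 0 j) * (x 0 i * w 0 i + x 0 j * w 0 j)
      / q x ^+ 3)).
Proof.
move=> xj; have q0 : q x != 0 by rewrite gt_eqF// axis_sqdist_gt0.
have dc (c : R^o) : is_diff x (cst c : E -> R^o) (fun=> 0) := is_diff_cst c x.
have dx k := is_diff_coord x k.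
have dqi := is_diff_inv q0 (is_diff_axis_sqdist i j x).
have dQ := is_diff_add (is_diff_mul (dx i) (dc (v 0 j)))
  (is_diff_mul (dc (-1 * v 0 i)) (dx j)).
have dP := is_diff_add (is_diff_mul (dx i) (dc (v 0 i)))
  (is_diff_mul (dx j) (dc (v 0 j))).
have ds := is_diff_add (is_diff_mul dQ dqi) (is_diff_mul
  (is_diff_cmul (-2 * eps) dP) (is_diff_mul dqi dqi)).
by apply: is_diff_eq ds _; apply/funext => w; rewrite /cst; field.
Qed.

End ConvexFunction.

(** * Strict convexity of the exponential of the tilted angle *)

Section StrictConvexity.
Context {R : realType} {n : nat}.
Local Notation E := 'rV[R]_n.+1.
Variables i j : 'I_n.+1.
Implicit Types x v w : E.
Local Notation q := (axis_sqdist i j).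

(** Let r be the squared distance to the axis, P = x_i v_i + x_j v_j half of its
derivative along v, u = P / r, t = dpsi (v) and N = |v|^2. Up to a positive
factor the expression is then the Hessian of the exponential along v, with
eps = m / 4 and L = 4 / m + 1. Both constants come from completing squares:
eps / r <= 1 / 4 bounds the square of t + 2 (eps / r) u by 2 t^2 + u^2 / 2, the
mixed term 2 r u t is at most eps u^2 + r^2 t^2 / eps, and
r L >= r^2 / eps + 4 eps absorbs all that is left in t^2, so that 2 eps N
remains. *)
Lemma hess_form_gt0 (m r N t u : R) : 0 < m -> m < r -> r <= 1 -> 0 < N ->
  0 < r * (4 / m + 1) * t ^+ 2 - 2 * r * u * t + 2 * (m / 4) * u ^+ 2
    - 2 * (m / 4) * (t + 2 * (m / 4 / r) * u) ^+ 2 + 2 * (m / 4) * N.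
Proof.
move=> m0 mr r1 N0; have r0 : 0 < r by exact: lt_trans mr.
set e := m / 4; have e0 : 0 < e by rewrite divr_gt0.
set k := e / r.
have k0 : 0 <= k by rewrite divr_ge0// ltW.
have k4 : k <= 1 / 4.
  by rewrite /k /e ler_pdivrMr//; lra.
have h1 : (t + 2 * k * u) ^+ 2 <= 2 * t ^+ 2 + u ^+ 2 / 2.
  have : 0 <= (t - 2 * k * u) ^+ 2 by exact: sqr_ge0.
  have : (k * u) ^+ 2 <= u ^+ 2 / 16.
    rewrite exprMn mulrC ler_wpM2l ?sqr_ge0//.
    have : k ^+ 2 <= (1 / 4) ^+ 2 by rewrite ler_pXn2r ?nnegrE.
    by lra.
  by lra.
have h2 : 0 <= e * u ^+ 2 - 2 * r * u * t + r ^+ 2 * t ^+ 2 / e.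
  have -> : e * u ^+ 2 - 2 * r * u * t + r ^+ 2 * t ^+ 2 / e =
      e * (u - r * t / e) ^+ 2 by field; rewrite gt_eqF.
  by rewrite mulr_ge0 ?sqr_ge0// ltW.
have h3 : (r ^+ 2 / e + 4 * e) * t ^+ 2 <= r * (4 / m + 1) * t ^+ 2.
  rewrite ler_wpM2r ?sqr_ge0//.
  have -> : r ^+ 2 / e = r * (4 / m) * r by rewrite /e; field; rewrite gt_eqF.
  rewrite mulrDr lerD//.
    by rewrite ler_piMr// mulr_ge0 ?divr_ge0// ltW.
  by rewrite /e; lra.
have h4 : 0 < e * N by exact: mulr_gt0.
have h5 : 2 * e * (t + 2 * k * u) ^+ 2 <= 2 * e * (2 * t ^+ 2 + u ^+ 2 / 2).
  by rewrite ler_pM2l// mulr_gt0.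
lra.
Qed.

Lemma axis_sqdist_le1 x : i != j -> sphere R n x -> q x <= 1.
Proof.
move=> ij Sx; rewrite -(sphereP Sx) /dot (bigD1 i)//= (bigD1 j) 1?eq_sym//=.
by rewrite addrA lerDl sumr_ge0// => k _; rewrite -expr2 sqr_ge0.
Qed.

Definition exp_tilted_angle (m : R) (x : E) : R :=
  expR ((4 / m + 1) * tilted_angle i j (m / 4) x).

Lemma Ck_exp_tilted_angle k (m : R) : 0 <= m ->
  Ck k.+1 (slit_region i j m) (exp_tilted_angle m : E -> R^o).
Proof.
move=> m0; have oW : open (slit_region i j m) by exact: open_slit_region.
apply: (Ck_expR oW); apply: (Ck_mul oW); last exact: Ck_tilted_angle.
exact: (Ck_cst _ _ (4 / m + 1 : R^o)).
Qed.

Lemma derive_exp_tilted_angle (m : R) x v : x 0 j < Num.sqrt (q x) ->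
  'D_v (exp_tilted_angle m : E -> R^o) x =
  exp_tilted_angle m x * ((4 / m + 1) * dtilted_angle i j (m / 4) v x).
Proof.
move=> xj.
have dtilt := is_diff_cmul (4 / m + 1) (is_diff_tilted_angle (m / 4) xj).
have := is_diff_comp1 dtilt (is_derive_expR _).
exact: is_diff_derive.
Qed.

Lemma derive2_exp_tilted_angle (m : R) x v : 0 <= m -> slit_region i j m x ->
  'D_v ('D_v (exp_tilted_angle m : E -> R^o)) x =
  exp_tilted_angle m x * (4 / m + 1) *
    ((4 / m + 1) * dtilted_angle i j (m / 4) v x ^+ 2
    + 'D_v (dtilted_angle i j (m / 4) v : E -> R^o) x).
Proof.
move=> m0 Wx; have oW : open (slit_region i j m) by exact: open_slit_region.
pose D y : R^o :=
  exp_tilted_angle m y * ((4 / m + 1) * dtilted_angle i j (m / 4) v y).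
rewrite (near_eq_derive (g := D)); last first.
  near=> y; apply: derive_exp_tilted_angle.
  suff : slit_region i j m y by case.
  by near: y; exact: open_nbhs_nbhs.
have dG : differentiable (exp_tilted_angle m : E -> R^o) x.
  by have [dW _] := Ck_exp_tilted_angle 0 m0; exact: dW.
have dth : differentiable (dtilted_angle i j (m / 4) v : E -> R^o) x.
  by have [dW _] := Ck_dtilted_angle i j 1 (m / 4) v m0; exact: dW.
have := is_diff_mul (differentiableP dG)
  (is_diff_cmul (4 / m + 1) (differentiableP dth)).
move=> /(is_diff_derive v) ->; rewrite -!deriveE// derive_exp_tilted_angle.
  by ring.
by case: Wx.
Unshelve. all: by end_near. Qed.

(** By [Hess_extension] the Hessian is an explicit rational expression times the
exponential, and [hess_form_gt0] applies. The normal derivative contributes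
2 eps |v|^2 / r^2 to the Hessian of psi, as eps / r^2 is homogeneous of degree
-2 and phi of degree 0. *)
Theorem strictly_convex_exp_tilted_angle (m : R) : i != j -> 0 < m ->
  strictly_convex (sphere R n `&` slit_region i j m) (exp_tilted_angle m).
Proof.
move=> ij m0; have oW : open (slit_region i j m) by exact: open_slit_region.
have C2 : sphere_Ck 2 (sphere R n `&` slit_region i j m)
    (exp_tilted_angle m : E -> R^o).
  move=> p [Sp Wp]; exists (slit_region i j m), (exp_tilted_angle m).
  split => //; by apply: Ck_exp_tilted_angle; exact: ltW.
split=> // X sX p [Sp Wp] Xp0.
set U := _ `&` _ in C2 sX.
have oU : sphere_open U by exists (slit_region i j m).
have [W [g [Y [oW' Wp' _ dY loc]]]] := local_extensions oU (conj Sp Wp) C2 sX.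
set W2 := slit_region i j m `&` W.
have oW2 : open W2 by exact: openI.
have -> := Hess_extension (W := W2) (g := exp_tilted_angle m) (Y := Y)
  oW2 (conj Wp Wp') Sp.
- rewrite derive2_exp_tilted_angle//; last exact: ltW.
  have pj : p 0 j < Num.sqrt (q p) by case: Wp.
  have q0 := axis_sqdist_gt0 pj.
  have dt := is_diff_dtilted_angle (m / 4) (X p) pj.
  rewrite derive_exp_tilted_angle// (is_diff_derive _ dt) => {dt}.
  set v := X p; set t := dtilted_angle i j (m / 4) v p.
  set u := (p 0 i * v 0 i + p 0 j * v 0 j) / q p.
  have N0 : 0 < dot v v by exact: dot_gt0.
  have mq : m < q p by case: Wp.
  have := hess_form_gt0 t u m0 mq (axis_sqdist_le1 ij Sp) N0.
  set S := (X in 0 < X -> _) => S0.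
  have -> : dtilted_angle i j (m / 4) p p = - 2 * (m / 4) / q p.
    by rewrite /dtilted_angle /axis_sqdist; field; rewrite gt_eqF.
  set G := exp_tilted_angle m p; have G0 : 0 < G by exact: expR_gt0.
  set L := 4 / m + 1; have L0 : 0 < L by rewrite addr_gt0// divr_gt0.
  suff -> : G * L * (L * t ^+ 2 + ((v 0 i * v 0 j - v 0 i * v 0 j) / q p
    - 2 * (p 0 i * v 0 j - v 0 i * p 0 j) * (p 0 i * v 0 i + p 0 j * v 0 j)
      / q p ^+ 2
    - 2 * (m / 4) * ((v 0 i * v 0 i + v 0 j * v 0 j) / q p ^+ 2
      - 4 * (p 0 i * v 0 i + p 0 j * v 0 j) * (p 0 i * v 0 i + p 0 j * v 0 j)
      / q p ^+ 3))) - dot v v * (G * (L * (- 2 * (m / 4) / q p))) =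
      G * L / q p * S.
    by rewrite mulr_gt0// divr_gt0// mulr_gt0.
  rewrite /S -/L /t /u /dtilted_angle; move: q0; rewrite /axis_sqdist => q0.
  field.
  by rewrite !gt_eqF.
- by apply: Ck_subset (Ck_exp_tilted_angle 1 (ltW m0)) => x [].
- by move=> x [_ /dY].
- by [].
- by move=> x [Sx [_ Wx]]; have [] := loc x (conj Sx Wx).
- by move=> x [Sx [_ Wx]]; have [] := loc x (conj Sx Wx).
Qed.

End StrictConvexity.

(** * The complement of the half-equator *)

Section HalfEquator.
Context {R : realType} {n : nat}.
Local Notation E := 'rV[R]_n.+1.
Implicit Types x p q : E.
Local Notation i0 := (ord0 : 'I_n.+1).
Local Notation i1 := (inord 1 : 'I_n.+1).

(** Matches the domain of the angle (left) with the complement of the slit as it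
appears in the definition of the half-equator (right). *)
Lemma slit_halfplaneP (a b : R) :
  (b < Num.sqrt (a * a + b * b)) = ~~ ((a == 0) && (0 <= b)).
Proof.
have [->|a0] := eqVneq a 0.
  rewrite mul0r add0r -expr2 sqrtr_sqr /= -ltNge.
  by case: (ltP b 0) => b0; [rewrite ltr0_norm//; lra|rewrite ger0_norm// ltxx].
have a2 : 0 < a * a by rewrite -expr2 exprn_even_gt0.
case: (ltP b 0) => b0 /=; first by rewrite (lt_le_trans b0)// sqrtr_ge0.
by rewrite -(ltr_pXn2r (n := 2))// ?nnegrE ?sqrtr_ge0// sqr_sqrtr; nra.
Qed.

Lemma compl_half_equator :
  sphere R n `\` half_equator R n = sphere R n `&` slit_region i0 i1 0.
Proof.
have slitE x : (x 0 i1 < Num.sqrt (axis_sqdist i0 i1 x)) =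
    ~~ ((x 0 i0 == 0) && (0 <= x 0 i1)) by exact: slit_halfplaneP.
apply/seteqP; split => x [Sx].
  move=> nhx; have xs : x 0 i1 < Num.sqrt (axis_sqdist i0 i1 x).
    by rewrite slitE; apply/negP => /andP[/eqP x0 x1]; apply: nhx.
  by split=> //; split=> //; exact: axis_sqdist_gt0.
move=> [_ /=]; rewrite slitE => /negP xs; split=> // -[_ x0 x1].
by apply: xs; rewrite x0 eqxx.
Qed.

(** On a nonempty compact set r^2 attains a positive minimum; half of it is a
strict lower bound for r^2 there. *)
Lemma compl_half_equator_convex_supporting : (0 < n)%N ->
  convex_supporting (sphere R n `\` half_equator R n).
Proof.
move=> n0; split=> [x []//|K cK KV].
have ij : i0 != i1 by rewrite -val_eqE /= inordK.
rewrite compl_half_equator in KV.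
suff [m m0 Km] : exists2 m, 0 < m & K `<=` sphere R n `&` slit_region i0 i1 m.
  exists (sphere R n `&` slit_region i0 i1 m); split => //.
    by exists (slit_region i0 i1 m) => //; exact: open_slit_region.
  by exists (exp_tilted_angle i0 i1 m); exact: strictly_convex_exp_tilted_angle.
have [->|K0] := eqVneq K set0; first by exists 1.
have [c /set_mem Kc cmin] : exists2 c, c \in K &
    forall x, x \in K -> axis_sqdist i0 i1 c <= axis_sqdist i0 i1 x.
  apply: EVT_min_rV => //; first exact/set0P.
  by apply: continuous_subspaceT; exact: continuous_axis_sqdist.
have c0 : 0 < axis_sqdist i0 i1 c by have [_ []] := KV c Kc.
exists (axis_sqdist i0 i1 c / 2); first by rewrite divr_gt0.
move=> x Kx; have [Sx [_ xs]] := KV x Kx.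
split=> //; split=> //=.
have := cmin x (mem_set Kx); lra.
Qed.

(** Push [p] in the direction of x_2 and project back to the sphere. *)
Lemma near_interior_half_equator (U : set E) p : (0 < n)%N ->
  sphere_open U -> U p -> half_equator R n p ->
  exists2 q, U q & [/\ sphere R n q, q 0 i0 = 0 & 0 < q 0 i1].
Proof.
move=> n0 [W oW ->] [Sp Wp] [_ p0 p1].
have ij : i0 != i1 by rewrite -val_eqE /= inordK.
pose y (s : R) : E := s *: delta_mx 0 i1 + p.
have cy : y s @[s --> 0^'+] --> p.
  have y0 : y 0 = p by rewrite /y scale0r add0r.
  rewrite -y0; apply: cvg_at_right_filter.
  apply: cvgD; last exact: cvg_cst.
  by apply: cvgZr_tmp; exact: cvg_id.
have : \forall s \near 0^'+, (sphere R n `&` W) (retr (y s)).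
  exact: cy (near_retr oW Sp Wp).
move=> nU; near (at_right (0 : R)) => s.
have s0 : 0 < s by [].
have Uy : (sphere R n `&` W) (retr (y s)) by near: s.
exists (retr (y s)) => //; split; first by case: Uy.
  by rewrite /retr /y !mxE p0 (negPf ij) !(mulr0, addr0).
have y1 : 0 < y s 0 i1 by rewrite /y !mxE !eqxx mulr1 ltr_wpDr.
rewrite /retr mxE mulr_gt0// invr_gt0 sqrtr_gt0 dot_gt0//.
by apply/eqP => y0; move: y1; rewrite y0 mxE ltxx.
Unshelve. all: by end_near. Qed.

(** On the great circle, x_1 = 0 only at [q] and - [q], and the latter has
x_2 < 0, hence is not on the half-equator. *)
Lemma great_circle_half_equator (U : set E) q :
  sphere R n `\` half_equator R n `<=` U -> U q ->
  sphere R n q -> q 0 i0 = 0 -> 0 < q 0 i1 ->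
  great_circle q (delta_mx 0 i0) `<=` U.
Proof.
move=> VU Uq Sq q0 q1 x [Sx xE].
have [[_ x0 x1]|nhx] := pselect (half_equator R n x); last exact: VU.
have xq : x = dot q x *: q.
  by rewrite {1}xE (dotC (delta_mx _ _)) dot_delta x0 scale0r addr0.
have d1 : dot q x ^+ 2 = 1.
  rewrite -(sphereP Sx) [in RHS]xq dotZl dotZr (sphereP Sq) mulr1.
  by rewrite expr2.
have d0 : 0 <= dot q x.
  by move: x1; rewrite {1}xq mxE pmulr_lge0.
suff d : dot q x = 1 by rewrite xq d scale1r.
by apply/eqP; rewrite -(eqrXn2 (n := 2))// d1 expr1n.
Qed.

End HalfEquator.

Theorem theorem2p1 (R : realType) (n : nat) (hn : (2 <= n)%N) :
  maximal_open_convex_supporting (sphere R n `\` half_equator R n).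
Proof.
have n0 : (0 < n)%N by exact: ltnW.
split.
- exists (slit_region (ord0 : 'I_n.+1) (inord 1) 0).
    exact: open_slit_region.
  exact: compl_half_equator.
- exact: compl_half_equator_convex_supporting.
move=> U oU [US Uconv] [VU /existsNP[p /not_implyP[Up pV]]].
have hp : half_equator R n p.
  by apply: contrapT => hp; apply: pV; split => //; exact: US.
have [q Uq [Sq q0 q1]] := near_interior_half_equator n0 oU Up hp.
pose e : 'rV[R]_n.+1 := delta_mx 0 ord0.
have e1 : dot e e = 1 by rewrite dot_delta mxE !eqxx.
have qe : dot q e = 0 by rewrite dot_delta.
have [W [oW KW [F Fconv]]] := Uconv _ (@compact_great_circle R n q e)
  (great_circle_half_equator VU Uq Sq q0 q1).
exact: (no_strictly_convex_great_circle (sphereP Sq) e1 qe oW KW Fconv).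
Qed.
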